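(* Let $N\ge1$ be a natural number and $h=\frac1N$. The quadrature formula $$\int_0^1\varphi(x)\,dx\cong\sum_{\beta=0}^N\bigl(C_0[\beta]\varphi(h\beta)+\mathring C_1[\beta]\varphi'(h\beta)\bigr)$$ with $C_0[0]=C_0[N]=\frac h2$, $C_0[\beta]=h$ for $1\le\beta\le N-1$, and $$\mathring C_1[0]=\frac{h(e^h+1)}{2(e^h-1)}-1,\qquad \mathring C_1[\beta]=0\ \ (1\le\beta\le N-1),\qquad \mathring C_1[N]=1-\frac{h(e^h+1)}{2(e^h-1)},$$ is exact for every function in $\mathbf F=\mathrm{span}\{1,\,x,\,e^x,\,e^{-x}\}$.
   Context: A quadrature formula is exact for $\varphi$ if its two sides are equal for this $\varphi$. The span is over the real numbers. *)

(* Defs.v *)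
From Stdlib Require Import Reals List Arith.
From Coquelicot Require Import Coquelicot.
Open Scope R_scope.

(* Real linear span of a finite list of functions R -> R; functions are
   compared pointwise. *)
Definition in_span (fs : list (R -> R)) (phi : R -> R) : Prop :=
  exists cs : list R, length cs = length fs /\
    forall x : R,
      phi x = fold_right Rplus 0
                (map (fun p : R * (R -> R) => fst p * snd p x) (combine cs fs)).

Definition F_generators : list (R -> R) :=
  (fun _ : R => 1) :: (fun x : R => x) ::
  (fun x : R => exp x) :: (fun x : R => exp (- x)) :: nil.

Definition mesh (N : nat) : R := 1 / INR N.

Definition coef0 (N beta : nat) : R :=
  if ((beta =? 0) || (beta =? N))%nat%bool then mesh N / 2 else mesh N.

(* The endpoints are distinct because these coefficients are only used for
   N >= 1. *)
Definition coef1 (N beta : nat) : R :=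
  let h := mesh N in
  if (beta =? 0)%nat then h * (exp h + 1) / (2 * (exp h - 1)) - 1
  else if (beta =? N)%nat then 1 - h * (exp h + 1) / (2 * (exp h - 1))
  else 0.

(* sum_f_R0 f N has N + 1 terms, f 0 + ... + f N. *)
Definition quadrature (N : nat) (a b : nat -> R) (phi : R -> R) : R :=
  sum_f_R0
    (fun beta : nat =>
       a beta * phi (mesh N * INR beta) + b beta * Derive phi (mesh N * INR beta))
    N.

(* RInt and Derive are total, so existence of the integral over [0, 1] and of
   the derivative at the nodes is part of the definition. *)
Definition exact_for (N : nat) (a b : nat -> R) (phi : R -> R) : Prop :=
  ex_RInt phi 0 1 /\
  (forall beta : nat, (beta <= N)%nat -> ex_derive phi (mesh N * INR beta)) /\
  RInt phi 0 1 = quadrature N a b phi.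

(* Main.v *)
Require Import Defs.
From Stdlib Require Import Reals List Arith Lra Lia.
From Coquelicot Require Import Coquelicot.
Open Scope R_scope.

(** The quadrature is the composite trapezoidal rule plus the end correction
    [(1 - K) (phi'(1) - phi'(0))], where [K = h (e^h + 1) / (2 (e^h - 1))].
    On [a + b x + c e^x + d e^(-x)], each panel of the trapezoidal rule is the
    exact increment of [a x + b x^2 / 2 + K (c e^x - d e^(-x))]; so the rule
    telescopes, and the end correction supplies the missing fraction [1 - K] of
    the exponential part of the antiderivative. *)

Lemma sum_f_R0_endpoints (N : nat) (u v : R) : (1 <= N)%nat ->
  sum_f_R0 (fun k => if (k =? 0)%nat then u else if (k =? N)%nat then v else 0) N
  = u + v.
Proof.
  intros hN.
  (* Partial sums that stop before [N] see only index 0. Since [N] is at least 1, the term [v]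
     enters exactly at the last step. *)
  assert (H : forall n, (n < N)%nat ->
    sum_f_R0 (fun k => if (k =? 0)%nat then u else if (k =? N)%nat then v else 0) n
    = u).
  { induction n as [|n IH]; intros hn; [reflexivity|].
    rewrite tech5, IH by lia.
    replace (S n =? 0)%nat with false by reflexivity.
    rewrite (proj2 (Nat.eqb_neq (S n) N)) by lia.
    ring. }
  destruct N as [|n]; [lia|].
  rewrite tech5, H by lia.
  rewrite Nat.eqb_refl. reflexivity.
Qed.

(** Adding the panels counts each interior node twice and each end node once, so the full sum
    exceeds the telescoped total by half of both end values. *)
Lemma trapezoid_telescope (h : R) (f G : nat -> R) :
  (forall k, h / 2 * (f k + f (S k)) = G (S k) - G k) ->
  forall n, h * sum_f_R0 f n = h / 2 * (f 0%nat + f n) + (G n - G 0%nat).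
Proof.
  intros step n; induction n as [|n IH].
  - simpl; field.
  - rewrite tech5, Rmult_plus_distr_l, IH.
    specialize (step n). lra.
Qed.

(** This is [(h/2) coth(h/2)], the ratio of the trapezoidal value to the exact integral of [exp]
    over a panel of length [h]. *)
Definition correction_weight (h : R) : R := h * (exp h + 1) / (2 * (exp h - 1)).

Lemma quadrature_trapezoid (N : nat) (phi : R -> R) : (1 <= N)%nat ->
  let h := mesh N in
  let K := correction_weight h in
  quadrature N (coef0 N) (coef1 N) phi =
  h * sum_f_R0 (fun k => phi (h * INR k)) N
  - h / 2 * (phi (h * INR 0) + phi (h * INR N))
  + (1 - K) * (Derive phi (h * INR N) - Derive phi (h * INR 0)).
Proof.
  intros hN h K.
  unfold quadrature; fold h.
  (* Weight [h] is given to every node; the remainder lives at the two ends only. *)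
  rewrite (sum_eq _ (fun k => phi (h * INR k) * h +
    (if (k =? 0)%nat
     then - (h / 2) * phi (h * INR 0) + (K - 1) * Derive phi (h * INR 0)
     else if (k =? N)%nat
     then - (h / 2) * phi (h * INR N) + (1 - K) * Derive phi (h * INR N)
     else 0))).
  - rewrite sum_plus, <- scal_sum, sum_f_R0_endpoints by assumption. ring.
  - intros k _.
    unfold coef0, coef1, K, correction_weight; fold h.
    destruct (Nat.eqb_spec k 0) as [-> | _]; simpl orb; cbv iota zeta; [lra|].
    destruct (Nat.eqb_spec k N) as [-> | _]; cbv iota; lra.
Qed.

Lemma exp_gt_1 (h : R) : 0 < h -> 1 < exp h.
Proof. intros hh. rewrite <- exp_0. now apply exp_increasing. Qed.

(** The trapezoidal rule is exact on affine functions. On [exp] it holds because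
    [h/2 * (exp h + 1) = K * (exp h - 1)]; reflection gives [exp (- x)]. *)
Lemma trapezoid_panel (a b c d h x : R) : 0 < h ->
  let K := correction_weight h in
  let f x := a + b * x + c * exp x + d * exp (- x) in
  let G x := a * x + b * x ^ 2 / 2 + K * (c * exp x - d * exp (- x)) in
  h / 2 * (f x + f (x + h)) = G (x + h) - G x.
Proof.
  intros hh K f G; unfold f, G, K, correction_weight.
  assert (H1 := exp_gt_1 h hh).
  assert (H2 := exp_pos x).
  rewrite Ropp_plus_distr, !exp_plus, !exp_Ropp.
  field. lra.
Qed.

Lemma in_span_F_generators (phi : R -> R) : in_span F_generators phi ->
  exists a b c d : R,
    forall x, phi x = a + b * x + c * exp x + d * exp (- x).
Proof.
  intros [cs [hlen heq]].
  destruct cs as [|a [|b [|c [|d [|e cs]]]]]; try discriminate hlen.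
  exists a, b, c, d; intros x; rewrite heq; simpl; ring.
Qed.

Theorem mainTheorem3 (N : nat) (hN : (1 <= N)%nat) (phi : R -> R)
  (hphi : in_span F_generators phi) :
  exact_for N (coef0 N) (coef1 N) phi.
Proof.
  destruct (in_span_F_generators phi hphi) as (a & b & c & d & heq).
  assert (hder : forall x, is_derive phi x (b + c * exp x - d * exp (- x))).
  { intros x.
    apply (is_derive_ext (fun x => a + b * x + c * exp x + d * exp (- x))).
    - intros t; symmetry; apply heq.
    - auto_derive; [trivial | ring]. }
  set (Phi := fun x => a * x + b * x ^ 2 / 2 + c * exp x - d * exp (- x)).
  assert (hint : is_RInt phi 0 1 (Phi 1 - Phi 0)).
  { apply (is_RInt_derive Phi phi).
    - intros x _; rewrite heq; unfold Phi; auto_derive; [trivial | field].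
    - intros x _; apply (ex_derive_continuous phi); eexists; apply hder. }
  split; [eexists; exact hint|].
  split; [intros k _; eexists; apply hder|].
  apply (eq_trans (A := R) (is_RInt_unique _ _ _ _ hint)).
  rewrite quadrature_trapezoid by assumption.
  assert (hNpos : 0 < INR N) by (apply lt_0_INR; lia).
  assert (hpos : 0 < mesh N) by (apply Rdiv_lt_0_compat; lra).
  assert (hend : mesh N * INR N = 1) by (unfold mesh; field; lra).
  set (K := correction_weight (mesh N)).
  (* [Phi] at the nodes, with its exponential part scaled by [K]. *)
  set (G := fun k => let x := mesh N * INR k in
    a * x + b * x ^ 2 / 2 + K * (c * exp x - d * exp (- x))).
  assert (step : forall k, mesh N / 2 * (phi (mesh N * INR k)
    + phi (mesh N * INR (S k))) = G (S k) - G k).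
  { intros k; unfold G.
    replace (mesh N * INR (S k)) with (mesh N * INR k + mesh N)
      by (rewrite S_INR; ring).
    rewrite !heq.
    now apply trapezoid_panel. }
  rewrite (trapezoid_telescope _ (fun k => phi (mesh N * INR k)) G step).
  rewrite !(is_derive_unique _ _ _ (hder _)); unfold G; rewrite hend.
  replace (mesh N * INR 0) with 0 by (simpl; ring).
  (* The end values of [phi] cancel, and so does [b] in the difference of derivatives; what is left
     there is the increment of the exponential part of [Phi], with weights [K] and [1 - K] adding up
     to 1. *)
  unfold Phi. field.
Qed.
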